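(* For all $n\geq1$, the $n$-dimensional hypercube graph $Q_n$ satisfies $\mathrm{pmd}(Q_n)\leq 2n-1$.
   Context: $Q_n$ is the graph with vertex set $\mathbb{Z}_2^n$ in which two vertices are adjacent if and only if they differ in exactly one coordinate. A matching $M$ (a set of pairwise disjoint edges) of a graph $\Gamma=(V,E)$ is positive if there is $w\colon V\to\mathbb{R}$ with $w(u)+w(v)>0$ for every $uv\in M$ and $w(u)+w(v)<0$ for every $uv\in E\setminus M$. A positive matching decomposition (pmd) of $\Gamma$ is a partition $E=E_1\cup\cdots\cup E_p$ into pairwise disjoint subsets such that $E_i$ is a positive matching of $(V,E\setminus\bigcup_{j<i}E_j)$ for $i=1,\ldots,p$. $\mathrm{pmd}(\Gamma)$ denotes the smallest $p$ for which $\Gamma$ has a pmd with $p$ parts. *)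

(* Defs.v *)
From HB Require Import structures.
From mathcomp Require Import all_boot all_order all_algebra.
From mathcomp Require Import boolp reals.

Set Implicit Arguments.
Unset Strict Implicit.
Unset Printing Implicit Defensive.

Import Order.TTheory GRing.Theory Num.Theory.
Local Open Scope ring_scope.

(* Finite simple graphs on the vertex type V; an edge uv is the unordered
   pair [set u; v]. *)
Record sgraph (V : finType) := SGraph {
  edges : {set {set V}};
  edges_card2 : forall e, e \in edges -> #|e| = 2
}.

Section Graphs.
Variable V : finType.
Implicit Types (G : sgraph V) (F M : {set {set V}}).

Lemma delete_edges_card2 G F e : e \in edges G :\: F -> #|e| = 2.
Proof. by rewrite inE => /andP[_ /edges_card2]. Qed.

Definition delete_edges G F : sgraph V := SGraph (@delete_edges_card2 G F).

Definition adj_edges (r : rel V) : {set {set V}} :=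
  [set [set uv.1; uv.2] | uv : V * V & r uv.1 uv.2].

Lemma adj_edges_card2 (r : rel V) (r_irr : irreflexive r) e :
  e \in adj_edges r -> #|e| = 2.
Proof.
case/imsetP=> -[u v]; rewrite inE /= => ruv ->.
by rewrite cards2; case: eqVneq ruv => // ->; rewrite r_irr.
Qed.

Definition graph_of_rel (r : rel V) (r_irr : irreflexive r) : sgraph V :=
  SGraph (adj_edges_card2 r_irr).

Definition matching G M : Prop := M \subset edges G /\ trivIset M.

(* [set u; u] is a singleton, hence never an edge, so u and v below are
   automatically distinct. *)
Definition positive_matching (R : realType) G M : Prop :=
  matching G M /\
  exists w : V -> R,
    (forall u v, [set u; v] \in M -> 0 < w u + w v) /\
    (forall u v, [set u; v] \in edges G :\: M -> w u + w v < 0).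

(* Parts may be empty; this does not affect the least number of parts. *)
Definition is_pmd (R : realType) G (p : nat)
    (E : 'I_p -> {set {set V}}) : Prop :=
  [/\ \bigcup_(i < p) E i = edges G,
      forall i j : 'I_p, i != j -> [disjoint E i & E j] &
      forall i : 'I_p, positive_matching R
                  (delete_edges G (\bigcup_(j < p | (j < i)%N) E j)) (E i)].

Definition has_pmd (R : realType) G (p : nat) : Prop :=
  exists E : 'I_p -> {set {set V}}, is_pmd R G E.

Lemma positive_matching1 (R : realType) G e :
  e \in edges G -> positive_matching R G [set e].
Proof.
move=> eG; split.
  split; first by rewrite sub1set.
  by apply/trivIsetP=> A B; rewrite !inE => /eqP-> /eqP->; rewrite eqxx.
exists (fun x => if x \in e then 1 else - 2%:R); split=> u v.
  by rewrite inE => /eqP <-; rewrite !inE !eqxx orbT addr_gt0.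
rewrite !inE => /andP[ne uvG].
have lt12 : 1 - 2%:R < 0 :> R by rewrite subr_lt0 ltr1n.
have n2 : - 2%:R < 0 :> R by rewrite oppr_lt0 ltr0n.
case: ifP => ue; case: ifP => ve; rewrite ?lt12 //.
- case/eqP: ne; apply/eqP; rewrite eqEcard subUset !sub1set ue ve /=.
  by rewrite (edges_card2 eG) (edges_card2 uvG).
- by rewrite addrC.
- by rewrite -opprD oppr_lt0 addr_gt0 // ltr0n.
Qed.

Lemma has_pmd_ex (R : realType) G : exists p, `[< has_pmd R G p >].
Proof.
exists #|edges G|; apply/asboolP; exists (fun i => [set enum_val i]); split.
- apply/setP=> e; apply/bigcupP/idP=> [[i _]|eG].
    by rewrite inE => /eqP->; exact: enum_valP.
  by exists (enum_rank_in eG e); rewrite // enum_rankK_in ?inE.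
- by move=> i j ij; rewrite disjoints1 inE (inj_eq enum_val_inj).
move=> i; apply: positive_matching1; rewrite /= inE enum_valP andbT.
apply/bigcupP=> -[j ji]; rewrite inE (inj_eq enum_val_inj) => /eqP ij.
by rewrite ij ltnn in ji.
Qed.

Definition pmd (R : realType) G : nat := ex_minn (has_pmd_ex R G).

End Graphs.

Definition hypercube_adj (n : nat) : rel 'rV['Z_2]_n :=
  fun x y => #|[set i | x 0 i != y 0 i]| == 1%N.

Lemma hypercube_adj_irr n : irreflexive (@hypercube_adj n).
Proof.
move=> x; rewrite /hypercube_adj.
have -> : [set i | x 0 i != x 0 i] = set0 by apply/setP=> i; rewrite !inE eqxx.
by rewrite cards0.
Qed.

Definition hypercube (n : nat) : sgraph 'rV['Z_2]_n :=
  graph_of_rel (@hypercube_adj_irr n).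

(* Main.v *)
Require Import Defs.
From mathcomp Require Import all_boot all_order all_algebra.
From mathcomp Require Import boolp reals.
From mathcomp Require Import zify.

(** Fix a direction [d] of the cube and a parity [b]. The edges in direction
    [d] whose endpoints have coordinates outside [d] summing to [b] mod 2 form a
    positive matching, and no edge has to be removed beforehand: give weight 1
    to the vertices with that sum and weight -2 to the others. An edge in
    direction [d] joins two vertices with the same sum, so its weight is 2 or
    -4; any other edge changes the sum, so its weight is -1.

    This already decomposes a cube of dimension [n] into [2n] positive
    matchings. One is saved at the end: when only the last direction is left,
    the remaining graph is itself a matching, and the constant weight 1 lets
    both of its parity classes be taken as a single part.

    The decomposition is presented as a colouring of the edges by natural
    numbers ([hypercube_colour]); [has_pmd_of_colouring] reduces being a positive
    matching decomposition to conditions on adjacent vertices. *)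

Set Implicit Arguments.
Unset Strict Implicit.
Unset Printing Implicit Defensive.

Import Order.TTheory GRing.Theory Num.Theory.
Local Open Scope ring_scope.

Lemma set2_inj (T : finType) (a b u v : T) :
  [set a; b] = [set u; v] -> (a = u /\ b = v) \/ (a = v /\ b = u).
Proof.
move=> E.
have := set21 a b; have := set22 a b; have := set21 u v; have := set22 u v.
rewrite E -{1 2}E !inE.
do 4![case/orP=> /eqP ?]; subst; auto.
Qed.

Section Colouring.
Variables (V : finType) (r : rel V) (r_irr : irreflexive r).
Hypothesis r_sym : symmetric r.

(** Symmetry matters here because [[set u; v]] forgets the order in which [u]
    and [v] were related. *)
Lemma mem_adj_edges u v : ([set u; v] \in adj_edges r) = r u v.
Proof.
apply/imsetP/idP => [[[a b]]|ruv]; last by exists (u, v); rewrite ?inE.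
by rewrite inE /= => rab /set2_inj[[-> ->]|[-> ->]] //; rewrite r_sym.
Qed.

Variable c : V -> V -> nat.
Hypothesis c_sym : forall u v, r u v -> c v u = c u v.

Definition colour_class (k : nat) : {set {set V}} :=
  adj_edges (fun u v => r u v && (c u v == k)).

Lemma mem_colour_class k u v :
  ([set u; v] \in colour_class k) = r u v && (c u v == k).
Proof.
apply/imsetP/idP => [[[a b]]|ruv]; last by exists (u, v); rewrite ?inE.
rewrite inE /= => /andP[rab cab] /set2_inj[[-> ->]|[-> ->]].
  by rewrite rab.
by rewrite r_sym rab c_sym.
Qed.

(** The colour classes are removed in increasing order of colour, so a weight
    for colour [k] must be negative only on the edges of larger colour. *)
Lemma has_pmd_of_colouring (R : realType) (p : nat) :
    (forall u v, r u v -> (c u v < p)%N) ->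
    (forall u v v', r u v -> r u v' -> c u v = c u v' -> v = v') ->
    (forall k, (k < p)%N -> exists w : V -> R, forall u v, r u v ->
       (c u v = k -> 0 < w u + w v) /\ ((k < c u v)%N -> w u + w v < 0)) ->
  has_pmd R (graph_of_rel r_irr) p.
Proof.
move=> c_lt c_inj c_pos; exists (fun i => colour_class i).
have classP k e : e \in colour_class k ->
    exists u v, [/\ e = [set u; v], r u v & c u v = k].
  by case/imsetP=> -[u v]; rewrite inE /= => /andP[? /eqP ?] ->; exists u, v.
have removed (i : 'I_p) u v : r u v ->
    ([set u; v] \in \bigcup_(j < p | (j < i)%N) colour_class j) = (c u v < i)%N.
  move=> ruv; apply/bigcupP/idP => [[j ji]|lt_i].
    by rewrite mem_colour_class ruv => /eqP ->.
  by exists (Ordinal (c_lt _ _ ruv)); rewrite ?mem_colour_class ?ruv /=.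
split.
- apply/setP=> e; apply/bigcupP/idP => [[j _ /classP[u [v [-> ruv _]]]]|].
    by rewrite mem_adj_edges.
  case/imsetP=> -[u v]; rewrite inE /= => ruv ->.
  by exists (Ordinal (c_lt _ _ ruv)); rewrite ?mem_colour_class ?ruv /=.
- move=> i j ij; apply/pred0P => e /=; apply/negbTE/negP => /andP[].
  case/classP=> [u [v [-> ruv cuv]]]; rewrite mem_colour_class => /andP[_].
  by rewrite cuv => /eqP/val_inj/eqP; rewrite (negbTE ij).
move=> i; split.
  split.
    apply/subsetP=> e /classP[u [v [-> ruv cuv]]].
    by rewrite /= inE removed // cuv ltnn mem_adj_edges.
  apply/trivIsetP=> A B /classP[a [b [-> rab cab]]] /classP[a' [b' [-> rab' cab']]].
  apply: contraR => /pred0Pn[x /= /andP[]].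
  (* Each edge is read from the vertex [x] they share, where [c_inj] applies. *)
  have thru u v y : y \in [set u; v] -> r u v -> c u v = i ->
      exists z, [/\ [set u; v] = [set y; z], r y z & c y z = i].
    rewrite !inE => /orP[]/eqP -> ruv cuv; first by exists v.
    by exists u; rewrite setUC r_sym c_sym.
  move=> /thru/(_ rab cab)[z [-> rz cz]] /thru/(_ rab' cab')[z' [-> rz' cz']].
  by rewrite (c_inj _ _ _ rz rz') ?cz.
have [w wP] := c_pos i (ltn_ord i); exists w; split=> u v.
  by rewrite mem_colour_class => /andP[ruv /eqP]; have [+ _] := wP _ _ ruv; apply.
rewrite /= !inE => /and3P[+ + ruv]; rewrite mem_adj_edges in ruv.
rewrite removed // mem_colour_class ruv /= -leqNgt => ne le.
by apply: (wP _ _ ruv).2; rewrite ltn_neqAle eq_sym ne.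
Qed.

End Colouring.

Lemma Z2_neq (a b : 'Z_2) : a != b -> (a != 0) = (b == 0).
Proof. by case: a => [[|[|?]] ?] //; case: b => [[|[|?]] ?]. Qed.

Lemma Z2_neq_eq (a b c : 'Z_2) : a != b -> a != c -> b = c.
Proof.
by case: a b c => [[|[|?]] ?] // [[|[|?]] ?] // [[|[|?]] ?] // _ _; apply: val_inj.
Qed.

Section Hypercube.
Variable m : nat.
Implicit Types (x y : 'rV['Z_2]_m.+1) (d e : 'I_m.+1).

Lemma hypercube_adj_sym : symmetric (@hypercube_adj m.+1).
Proof.
by move=> x y; congr (_ == _); apply: eq_card => i; rewrite !inE eq_sym.
Qed.

(** The default value [ord0] only serves when [x = y]. *)
Definition direction x y : 'I_m.+1 := odflt ord0 [pick i | x 0 i != y 0 i].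

Lemma hypercube_adjP x y :
  hypercube_adj x y -> forall i, (x 0 i != y 0 i) = (i == direction x y).
Proof.
move=> /cards1P[d /setP D] i.
have {}D j : (x 0 j != y 0 j) = (j == d) by have := D j; rewrite !inE.
rewrite D /direction; case: pickP => [j|/(_ d)]; rewrite D ?eqxx //.
by move=> /eqP ->.
Qed.

Lemma direction_sym x y : direction y x = direction x y.
Proof. by congr odflt; apply: eq_pick => i; rewrite eq_sym. Qed.

Definition parity_off d x : bool := \sum_(i | i != d) x 0 i != 0.

Lemma parity_off_direction x y : hypercube_adj x y ->
  parity_off (direction x y) y = parity_off (direction x y) x.
Proof.
move=> /hypercube_adjP D; congr (_ != 0); apply: eq_bigr => i.
by rewrite -D negbK => /eqP.
Qed.

Lemma parity_off_neq x y d : hypercube_adj x y -> d != direction x y ->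
  parity_off d y = ~~ parity_off d x.
Proof.
move=> /hypercube_adjP D; rewrite eq_sym => ne.
rewrite /parity_off negbK; apply: Z2_neq.
rewrite (bigD1 (direction x y)) //= [X in _ != X](bigD1 (direction x y)) //=.
rewrite (eq_bigr (fun i => x 0 i)) => [|i /andP[_]].
  by rewrite (inj_eq (addIr _)) eq_sym D.
by rewrite -D negbK eq_sym => /eqP.
Qed.

(** Colours [2d] and [2d+1] are the two parity classes of direction [d], except
    that those of the last direction [m] share the colour [2m], which makes
    [2m+1] colours in all. *)
Definition hypercube_colour x y : nat :=
  let d := direction x y in (d.*2 + ((d < m) && parity_off d x))%N.

Lemma hypercube_colour_half x y : (hypercube_colour x y)./2 = direction x y.
Proof. by rewrite /hypercube_colour addnC half_bit_double. Qed.

Lemma hypercube_colour_sym x y : hypercube_adj x y ->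
  hypercube_colour y x = hypercube_colour x y.
Proof.
by move=> xy; rewrite /hypercube_colour direction_sym parity_off_direction.
Qed.

Lemma hypercube_colour_le x y : (hypercube_colour x y <= m.*2)%N.
Proof.
rewrite /hypercube_colour; have := ltn_ord (direction x y).
by case: (ltnP (direction x y) m); case: parity_off => /=; lia.
Qed.

(** The colour of an edge at [x] determines its direction, hence its other
    endpoint: this is why each colour class is a matching. *)
Lemma hypercube_colour_inj x y y' : hypercube_adj x y -> hypercube_adj x y' ->
  hypercube_colour x y = hypercube_colour x y' -> y = y'.
Proof.
move=> /hypercube_adjP D /hypercube_adjP D' /(congr1 half).
rewrite !hypercube_colour_half => /val_inj dd'; apply/rowP=> i.
have := D i; have := D' i; rewrite -dd'; case: (i == _); last first.
  by move=> /negbFE/eqP <- /negbFE/eqP.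
by move=> xy' xy; apply: Z2_neq_eq xy xy'.
Qed.

(** The constant weight 1 is used for the last colour, when no other edges
    remain; for a smaller colour the value -2 makes an edge with exactly one
    endpoint of the right parity negative. *)
Definition colour_weight (R : realType) (k : nat) x : R :=
  if (k == m.*2) || (parity_off (inord k./2) x == odd k) then 1 else - 2%:R.

Lemma colour_weightP (R : realType) k x y : hypercube_adj x y ->
  (hypercube_colour x y = k -> 0 < colour_weight R k x + colour_weight R k y) /\
  ((k < hypercube_colour x y)%N -> colour_weight R k x + colour_weight R k y < 0).
Proof.
move=> xy; set d := direction x y.
have dm : (d <= m)%N by rewrite -ltnS.
split=> [<-|lt_k]; rewrite /colour_weight.
  rewrite hypercube_colour_half inord_val parity_off_direction //.
  suff -> : (hypercube_colour x y == m.*2) ||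
      (parity_off d x == odd (hypercube_colour x y)) by rewrite addr_gt0.
  rewrite /hypercube_colour -/d oddD odd_double /=.
  have [_|md] := ltnP d m; first by case: parity_off; rewrite orbT.
  by rewrite (anti_leq (introT andP (conj dm md))) addn0 eqxx.
have k_lt : (k < m.*2)%N by apply: leq_trans lt_k (hypercube_colour_le x y).
have lt12 : 1 - 2%:R < 0 :> R by rewrite subr_lt0 ltr1n.
have n2 : - 2%:R < 0 :> R by rewrite oppr_lt0 ltr0n.
rewrite (ltn_eqF k_lt) /=.
have [de|ne] := eqVneq (inord k./2) d; last first.
  rewrite (parity_off_neq xy ne).
  by case: parity_off; case: odd => //=; rewrite addrC.
rewrite de parity_off_direction // -/d.
(* Here [d = k./2], so a colour above [k] in direction [d] is [k.+1], [k] even. *)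
suff /negbTE -> : parity_off d x != odd k by rewrite -opprD oppr_lt0 addr_gt0 // ltr0n.
have k2 : k./2 = d by rewrite -de inordK //; lia.
move: lt_k; rewrite /hypercube_colour -/d -[k in (k < _)%N]odd_double_half k2.
by case: parity_off; case: odd; rewrite ?andbF ?andbT //=; lia.
Qed.

End Hypercube.

Theorem proposition4p4 (R : realType) (n : nat) (hn : (1 <= n)%N) :
  (pmd R (hypercube n) <= 2 * n - 1)%N.
Proof.
case: n hn => // m _.
suff H : has_pmd R (hypercube m.+1) (2 * m.+1 - 1).
  by rewrite /pmd; case: ex_minnP => p _; apply; apply/asboolP.
apply: (@has_pmd_of_colouring _ _ _ (@hypercube_adj_sym m) (@hypercube_colour m)).
- exact: hypercube_colour_sym.
- by move=> x y _; have := hypercube_colour_le x y; lia.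
- exact: hypercube_colour_inj.
by move=> k _; exists (colour_weight R k) => x y; apply: colour_weightP.
Qed.
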